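(* Let $k$ be a field with $\operatorname{char} k\neq 2$ and let $n\geq 4$ be an even integer. Let $W_n$ be the $k$-algebra generated by $x_1,\dots,x_n$ subject to the relations $x_ix_j+x_jx_i=1$ for all $i\neq j$. Then $\operatorname{Aut}(W_n)=S_n\times\{\pm 1\}$.
   Context: $\operatorname{Aut}(W_n)$ denotes the group of all $k$-algebra automorphisms of $W_n$. The symmetric group $S_n$ acts on $W_n$ by algebra automorphisms permuting the generators, $x_i\mapsto x_{\sigma(i)}$, and $-1$ acts by the algebra automorphism $x_i\mapsto -x_i$ for all $i$; in this way $S_n\times\{\pm1\}$ is regarded as a subgroup of $\operatorname{Aut}(W_n)$, and the claim is that it is the whole group. *)

(* Defs.v *)
From HB Require Import structures.
From mathcomp Require Import all_boot all_algebra all_fingroup.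
From mathcomp Require Import boolp.
From mathcomp Require Import finmap monalg.

Set Implicit Arguments.
Unset Strict Implicit.
Unset Printing Implicit Defensive.

Import GRing.Theory.
Local Open Scope ring_scope.
Local Open Scope quotient_scope.

Section TwoSidedIdeal.
Variables (R : nzRingType) (P : R -> Prop).

Inductive ideal_gen : R -> Prop :=
| ideal_gen0 : ideal_gen 0
| ideal_genD u v : ideal_gen u -> ideal_gen v -> ideal_gen (u + v)
| ideal_genM a r b : P r -> ideal_gen (a * r * b).

Lemma ideal_genMl a u : ideal_gen u -> ideal_gen (a * u).
Proof.
elim=> [|{}u v _ IHu _ IHv|b r c Pr]; first by rewrite mulr0; exact: ideal_gen0.
- by rewrite mulrDr; exact: ideal_genD.
- by rewrite !mulrA; exact: ideal_genM.
Qed.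

Lemma ideal_genMr a u : ideal_gen u -> ideal_gen (u * a).
Proof.
elim=> [|{}u v _ IHu _ IHv|b r c Pr]; first by rewrite mul0r; exact: ideal_gen0.
- by rewrite mulrDl; exact: ideal_genD.
- by rewrite -mulrA; exact: ideal_genM.
Qed.

Lemma ideal_genN u : ideal_gen u -> ideal_gen (- u).
Proof. by rewrite -mulN1r; exact: ideal_genMl. Qed.

Lemma ideal_gen_eqmod_equiv :
  equiv_class_of (fun u v => `[< ideal_gen (u - v) >]).
Proof.
split=> [u|u v|v u w].
- by apply/asboolP; rewrite subrr; exact: ideal_gen0.
- by apply/asboolP/asboolP => /ideal_genN; rewrite opprB.
- move=> /asboolP uv /asboolP vw; apply/asboolP.
  by rewrite -(subrK v u) -addrA; exact: ideal_genD.
Qed.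

End TwoSidedIdeal.

Section Evaluation.
Variables (k : fieldType) (n : nat) (A : algType k) (y : 'I_n -> A).

Definition monom_eval (m : {fmonom 'I_n}) : A := \prod_(i <- m) y i.

Fact monom_eval_morph : mmorphism monom_eval.
Proof.
split=> [u v|]; first by rewrite /monom_eval fmM big_cat.
by rewrite /monom_eval fm1 big_nil.
Qed.
HB.instance Definition _ :=
  monalg.isMultiplicative.Build _ _ monom_eval monom_eval_morph.

Definition free_eval : {malg k[{fmonom 'I_n}]} -> A := mmap (in_alg A) monom_eval.

Fact free_eval_zmod : zmod_morphism free_eval.
Proof. exact: mmap_is_additive. Qed.
HB.instance Definition _ :=
  GRing.isZmodMorphism.Build _ _ free_eval free_eval_zmod.

Fact free_eval_monoid : monoid_morphism free_eval.
Proof.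
have [M E] : multiplicative free_eval.
  apply: commr_mmap_is_multiplicative => u m m'.
  by rewrite /GRing.comm /= -scalerAl -scalerAr mul1r mulr1.
by [].
Qed.
HB.instance Definition _ :=
  GRing.isMonoidMorphism.Build _ _ free_eval free_eval_monoid.

Lemma free_evalX i : free_eval << fmu i >> = y i.
Proof. by rewrite /free_eval mmapU /= scale1r mul1r /monom_eval fmU big_seq1. Qed.

End Evaluation.

Lemma free_scalerAr (k : fieldType) n (a : k) (u v : {malg k[{fmonom 'I_n}]}) :
  a *: (u * v) = u * (a *: v).
Proof.
apply/malgP => m; rewrite mcoeffZ mcoeffMl.
rewrite (mcoeffMlw _ (fsubset_refl _) (msuppZ_le a v)) mulr_sumr.
apply: eq_bigr => m1 _; rewrite mulr_sumr; apply: eq_bigr => m2 _.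
by rewrite mcoeffZ mulrnAr mulrCA.
Qed.

(* W is the quotient of the free algebra k<X_i | i < n> by the two-sided ideal
   generated by the W_relators; relation 'mod W' is classical membership. *)
Section Presentation.
Variables (k : fieldType) (n : nat).

Local Notation free := {malg k[{fmonom 'I_n}]}.
Local Notation X i := (<< fmu i >> : free).

Definition W_relator (r : free) : Prop :=
  exists i j : 'I_n, i != j /\ r = X i * X j + X j * X i - 1.

Definition W_eqmod : rel free :=
  fun u v => `[< ideal_gen W_relator (u - v) >].

Canonical W_equiv :=
  EquivRelPack (ideal_gen_eqmod_equiv W_relator : equiv_class_of W_eqmod).
Canonical W_encModRel := defaultEncModRel W_eqmod.

Definition W := {eq_quot W_eqmod}.

HB.instance Definition _ : EqQuotient free W_eqmod W := EqQuotient.on W.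
HB.instance Definition _ := Choice.on W.

Lemma W_eqP (u v : free) :
  reflect (ideal_gen W_relator (u - v)) (u == v %[mod W]).
Proof. by rewrite eqmodE; exact: asboolP. Qed.

Definition W_zero : W := lift_cst W 0.
Definition W_one : W := lift_cst W 1.
Definition W_opp := lift_op1 W (-%R : free -> free).
Definition W_add := lift_op2 W (+%R : free -> free -> free).
Definition W_mul := lift_op2 W ( *%R : free -> free -> free).
Definition W_scale (c : k) := lift_op1 W (fun u : free => c *: u).

Canonical W_zero_morph := PiConst W_zero.
Canonical W_one_morph := PiConst W_one.

Lemma pi_W_opp : {morph \pi_W : u / - u >-> W_opp u}.
Proof.
move=> u; unlock W_opp; apply/eqP/W_eqP.
rewrite -opprD; apply: ideal_genN; apply/W_eqP.
by rewrite reprK.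
Qed.
Canonical W_opp_morph := PiMorph1 pi_W_opp.

Lemma pi_W_add : {morph \pi_W : u v / u + v >-> W_add u v}.
Proof.
move=> u v; unlock W_add; apply/eqP/W_eqP.
rewrite opprD addrACA; apply: ideal_genD; apply/W_eqP; by rewrite reprK.
Qed.
Canonical W_add_morph := PiMorph2 pi_W_add.

Lemma pi_W_mul : {morph \pi_W : u v / u * v >-> W_mul u v}.
Proof.
move=> u v; unlock W_mul; apply/eqP/W_eqP.
have E u' v' : u * v - u' * v' = (u - u') * v + u' * (v - v').
  by rewrite mulrBl mulrBr addrA subrK.
rewrite E; apply: ideal_genD; [apply: ideal_genMr | apply: ideal_genMl];
  by apply/W_eqP; rewrite reprK.
Qed.
Canonical W_mul_morph := PiMorph2 pi_W_mul.

Lemma pi_W_scale c : {morph \pi_W : u / c *: u >-> W_scale c u}.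
Proof.
move=> u; unlock W_scale; apply/eqP/W_eqP.
rewrite -scalerBr -mul_malgC; apply: ideal_genMl; apply/W_eqP.
by rewrite reprK.
Qed.
Canonical W_scale_morph c := PiMorph1 (pi_W_scale c).

Fact W_addA : associative W_add.
Proof. by move=> x y z; rewrite -[x]reprK -[y]reprK -[z]reprK !piE addrA. Qed.
Fact W_addC : commutative W_add.
Proof. by move=> x y; rewrite -[x]reprK -[y]reprK !piE addrC. Qed.
Fact W_add0 : left_id W_zero W_add.
Proof. by move=> x; rewrite -[x]reprK !piE add0r. Qed.
Fact W_addN : left_inverse W_zero W_opp W_add.
Proof. by move=> x; rewrite -[x]reprK !piE addNr. Qed.

HB.instance Definition _ :=
  GRing.isZmodule.Build W W_addA W_addC W_add0 W_addN.

Fact W_mulA : associative W_mul.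
Proof. by move=> x y z; rewrite -[x]reprK -[y]reprK -[z]reprK !piE mulrA. Qed.
Fact W_mul1l : left_id W_one W_mul.
Proof. by move=> x; rewrite -[x]reprK !piE mul1r. Qed.
Fact W_mul1r : right_id W_one W_mul.
Proof. by move=> x; rewrite -[x]reprK !piE mulr1. Qed.
Fact W_mulDl : left_distributive W_mul W_add.
Proof. by move=> x y z; rewrite -[x]reprK -[y]reprK -[z]reprK !piE mulrDl. Qed.
Fact W_mulDr : right_distributive W_mul W_add.
Proof. by move=> x y z; rewrite -[x]reprK -[y]reprK -[z]reprK !piE mulrDr. Qed.

(* Nontriviality of W, in every characteristic: the relations are extended from
   m to m + 1 generators by y_j |-> [y_j, 1; 0, - y_j] together with
   [0, 0; 1, 0]. *)
Lemma W_matrix_rep m : exists N (y : 'I_m -> 'M[k]_N.+1),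
  forall i j, i != j -> y i *m y j + y j *m y i = 1%:M.
Proof.
elim: m => [|m [N [y yP]]]; first by exists 0%N, (fun=> 0) => -[].
pose z (i : 'I_m.+1) : 'M[k]_(N.+1 + N.+1) :=
  if unlift ord0 i is Some j then block_mx (y j) 1%:M 0 (- y j)
  else block_mx 0 0 1%:M 0.
suff zP i j : i != j -> z i *m z j + z j *m z i = 1%:M.
  by exists (N + N.+1)%N, z.
pose simpB := (mulmx_block, add_block_mx, mulmx0, mul0mx, mul1mx, mulmx1,
  mulNmx, mulmxN, add0r, addr0, opprK).
rewrite (scalar_mx_block N.+1 N.+1) /z.
case: unliftP => [i'|] ->; case: unliftP => [j'|] -> //.
- rewrite (inj_eq lift_inj) => /yP yij; rewrite !simpB yij.
  by rewrite -(opprB (y i')) subrr.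
- by rewrite !simpB addNr.
- by rewrite !simpB subrr.
Qed.

Fact W_one_neq0 : (W_one : W) != 0.
Proof.
have [N [y yP]] := W_matrix_rep n.
have yR i j : i != j -> y i * y j + y j * y i = 1 by exact: yP.
have kill u : ideal_gen W_relator u -> free_eval y u = 0.
  elim=> [|{}u v _ IHu _ IHv|a r b [i [j [ij ->]]]]; first exact: raddf0.
  - by rewrite raddfD /= IHu IHv addr0.
  - rewrite !rmorphM rmorphB rmorphD !rmorphM rmorph1 /= !free_evalX.
    by rewrite yR // subrr mulr0 mul0r.
rewrite !piE; apply/asboolPn; rewrite subr0 => /kill/eqP.
by rewrite rmorph1 oner_eq0.
Qed.

HB.instance Definition _ := GRing.Zmodule_isNzRing.Build W
  W_mulA W_mul1l W_mul1r W_mulDl W_mulDr W_one_neq0.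

Fact W_scaleA a b x : W_scale a (W_scale b x) = W_scale (a * b) x.
Proof. by rewrite -[x]reprK !piE scalerA. Qed.
Fact W_scale1 : left_id 1 W_scale.
Proof. by move=> x; rewrite -[x]reprK !piE scale1r. Qed.
Fact W_scaleDr : right_distributive W_scale +%R.
Proof. by move=> a x y; rewrite -[x]reprK -[y]reprK !piE scalerDr. Qed.
Fact W_scaleDl x : {morph W_scale^~ x : a b / a + b}.
Proof. by move=> a b; rewrite -[x]reprK !piE scalerDl. Qed.

HB.instance Definition _ := GRing.Zmodule_isLmodule.Build k W
  W_scaleA W_scale1 W_scaleDr W_scaleDl.

Fact W_scaleAl a x y : W_scale a (W_mul x y) = W_mul (W_scale a x) y.
Proof. by rewrite -[x]reprK -[y]reprK !piE scalerAl. Qed.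
HB.instance Definition _ := GRing.Lmodule_isLalgebra.Build k W W_scaleAl.

Fact W_scaleAr a x y : W_scale a (W_mul x y) = W_mul x (W_scale a y).
Proof. by rewrite -[x]reprK -[y]reprK !piE free_scalerAr. Qed.
HB.instance Definition _ := GRing.Lalgebra_isAlgebra.Build k W W_scaleAr.

Definition W_gen (i : 'I_n) : W := \pi_W << fmu i >>.

Lemma W_genP i j : i != j -> W_gen i * W_gen j + W_gen j * W_gen i = 1.
Proof.
move=> ij; change (W_add (W_mul (W_gen i) (W_gen j))
  (W_mul (W_gen j) (W_gen i)) = W_one).
rewrite !piE; apply/eqP/W_eqP.
rewrite -[_ - _]mulr1 -[_ - _]mul1r.
by apply: ideal_genM; exists i, j.
Qed.

End Presentation.

Section Automorphisms.
Variables (k : fieldType) (A : algType k).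

Record alg_aut := AlgAut {
  alg_aut_fun :> A -> A;
  alg_aut_linear : linear alg_aut_fun;
  alg_aut_monoid : monoid_morphism alg_aut_fun;
  alg_aut_bij : bijective alg_aut_fun
}.

Lemma alg_autP (f g : alg_aut) : f =1 g -> f = g.
Proof.
case: f g => [f fl fm fb] [g gl gm gb] /= /funext fg.
by case: g / fg in gl gm gb *; congr AlgAut.
Qed.

HB.instance Definition _ := gen_eqMixin alg_aut.
HB.instance Definition _ := gen_choiceMixin alg_aut.

Definition alg_aut_one : alg_aut.
Proof.
exists (@id A) => //; exact: (Bijective (g := id)).
Defined.

(* Products are read left to right, (f * g) x = g (f x), as in {perm T}, so that
   s |-> (x_i |-> x_(s i)) is a homomorphism and not an antihomomorphism. *)
Definition alg_aut_mul (f g : alg_aut) : alg_aut.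
Proof.
exists (g \o f) => /=.
- by move=> a x y /=; rewrite alg_aut_linear alg_aut_linear.
- case: (alg_aut_monoid f) => f1 fM; case: (alg_aut_monoid g) => g1 gM.
  by split=> [|x y] /=; rewrite ?f1 ?fM.
- exact: bij_comp (alg_aut_bij g) (alg_aut_bij f).
Defined.

Lemma alg_aut_inv_subproof (f : alg_aut) :
  exists g : alg_aut, cancel f g /\ cancel g f.
Proof.
have [g fK gK] := alg_aut_bij f.
have gl : linear g.
  by move=> a x y; apply: (can_inj fK); rewrite gK alg_aut_linear !gK.
have gm : monoid_morphism g.
  have [f1 fM] := alg_aut_monoid f.
  split=> [|x y]; first by apply: (can_inj fK); rewrite gK f1.
  by apply: (can_inj fK); rewrite gK fM !gK.
by exists (AlgAut gl gm (Bijective gK fK)).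
Qed.

Definition alg_aut_inv (f : alg_aut) : alg_aut :=
  projT1 (cid (alg_aut_inv_subproof f)).

Fact alg_aut_mulA : associative alg_aut_mul.
Proof. by move=> f g h; apply: alg_autP. Qed.
Fact alg_aut_mul1 : left_id alg_aut_one alg_aut_mul.
Proof. by move=> f; apply: alg_autP. Qed.
Fact alg_aut_mulr1 : right_id alg_aut_one alg_aut_mul.
Proof. by move=> f; apply: alg_autP. Qed.
Fact alg_aut_mulV : left_inverse alg_aut_one alg_aut_inv alg_aut_mul.
Proof.
move=> f; apply: alg_autP => x /=; rewrite /alg_aut_inv.
by case: cid => g [fK gK] /=.
Qed.
Fact alg_aut_mulrV : right_inverse alg_aut_one alg_aut_inv alg_aut_mul.
Proof.
move=> f; apply: alg_autP => x /=; rewrite /alg_aut_inv.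
by case: cid => g [fK gK] /=.
Qed.

HB.instance Definition _ := isGroup.Build alg_aut
  alg_aut_mulA alg_aut_mul1 alg_aut_mulr1 alg_aut_mulV alg_aut_mulrV.

End Automorphisms.

(* Main.v *)
From HB Require Import structures.
Require Import Defs.
From mathcomp Require Import all_boot all_order all_algebra all_fingroup.
From mathcomp Require Import generic_quotient ssrcomplements zify ring.
From mathcomp Require finmap monalg mpoly.

Set Implicit Arguments.
Unset Strict Implicit.
Unset Printing Implicit Defensive.

Import Order.TTheory GRing.Theory.
Local Open Scope ring_scope.

(** Why the theorem is true.  Give each generator degree 1.  The associated graded
    algebra of W is the skew polynomial ring in which distinct variables
    anticommute, a domain, so degrees in W add up under multiplication
    ([wsizeM]).  The squares of the generators are central, hence W is spanned
    over its centre by the 2^n products of distinct generators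
    ([central_decomposition]).

    Let g be an automorphism with inverse f, and let y_i be the image of x_i
    under f.  Write the image of x_j under g as a sum over subsets S of a central
    z_S times the product x_S of the generators in S; applying f expresses x_j
    itself as the sum of the f(z_S) y_S.  The y_i satisfy the same relations and
    have degree at least 1, so to leading order each y_i commutes or
    anticommutes with y_S, and for n even the sign patterns of distinct S differ.
    Twisting by the y_i therefore separates the terms, which shows that nothing
    cancels in top degree: each f(z_S) y_S has degree at most that of the sum,
    which is 1 ([wsize_term_le]).  So only S with at most one element occur, with
    central coefficients of degree at most 1, and those are scalars
    ([central_affine]).  Hence g(x_j) is a scalar plus a linear combination of
    generators ([aut_gen_affine]).

    Comparing coefficients in the relations between the g(x_i) then leaves only
    a monomial matrix and no constant terms; the surviving coefficients satisfy
    b_i b_l = 1 for all distinct i and l, which for n > 2 makes them all equal to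
    1 or all equal to -1 ([aut_classification]).  Conversely the signed
    permutations of the generators extend to automorphisms by the universal
    property of W.

    The degree is defined through a faithful model.  W acts on the commutative
    polynomials in n variables, x_i acting as a signed multiplication by the
    i-th variable plus half of a degree-lowering operator; the symbol of w is
    w applied to 1.  Sorted words in the generators span W and their symbols
    have distinct leading monomials, so the symbol map is injective and transports
    leading monomials and degrees to W. *)

(** * The universal property of W and its linear representations *)

Module Presentation.
Import finmap monalg.
Local Open Scope quotient_scope.

Lemma lin_mull (R : nzRingType) (A : lalgType R) c (u v w : A) :
  (c *: u + v) * w = c *: (u * w) + v * w.
Proof. by rewrite mulrDl scalerAl. Qed.

Section RelatorTransport.
Variables (R S : nzRingType) (V : zmodType) (a b : R).

Lemma rmorph_relator (f : {rmorphism R -> S}) c d :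
  f a * f b + f b * f a = 1 -> f (c * (a * b + b * a - 1) * d) = 0.
Proof.
move=> fab; rewrite 2!rmorphM rmorphB rmorphD rmorph1 !rmorphM fab.
by rewrite subrr mulr0 mul0r.
Qed.

Lemma act_relator (f : {additive R -> V}) (A B : V -> V) c :
  (forall u, f (a * u) = A (f u)) -> (forall u, f (b * u) = B (f u)) ->
  (forall v, A (B v) + B (A v) = v) -> f ((a * b + b * a - 1) * c) = 0.
Proof.
move=> fa fb AB; rewrite mulrBl mulrDl mul1r -!mulrA raddfB raddfD !(fa, fb).
by rewrite AB subrr.
Qed.

End RelatorTransport.

Section Quotient.
Variables (k : fieldType) (n : nat).
Local Notation free := {malg k[{fmonom 'I_n}]}.
Local Notation X i := (<< fmu i >> : free).
Local Notation W := (W k n).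
Local Notation x := (W_gen k).

(** Words are built by prepending letters, so closure under left multiplication
    by the letters and under linear combinations reaches the whole algebra. *)
Lemma free_ind (Q : free -> Prop) :
  Q 1 -> (forall a u v, Q u -> Q v -> Q (a *: u + v)) ->
  (forall i u, Q u -> Q (X i * u)) -> forall u, Q u.
Proof.
move=> Q1 Qlin QX u; have Q0 : Q 0 by rewrite -(addNr 1) -scaleN1r; apply: Qlin.
rewrite [u]monalgE; elim/big_rec: _ => // m v _ Qv.
have -> : << u@_m *g m >> = u@_m *: (<< m >> : free).
  by apply/malgP => m'; rewrite mcoeffZ !mcoeffU mulrnAr mulr1.
apply: Qlin => //; case: m => s; elim: s => [|i s IH].
  by rewrite -fmoneE.
suff -> : (<< FMonom (i :: s) >> : free) = X i * << FMonom s >>.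
  exact: QX.
rewrite malgM_def fgmulUU mulr1; congr (<< _ >>).
by apply/eqP; rewrite fmP fmM fmU.
Qed.

Definition W_proj (u : free) : W := \pi_W u.

Lemma W_projK w : W_proj (repr w) = w.
Proof. exact: reprK. Qed.

Lemma W_proj_linear : linear W_proj.
Proof.
move=> a u v; rewrite /W_proj; change (\pi_W (a *: u + v) = W_add (W_scale a (\pi_W u)) (\pi_W v)).
by rewrite !piE.
Qed.
HB.instance Definition _ :=
  GRing.isLinear.Build k free W *:%R W_proj W_proj_linear.

Lemma W_proj_monoid : monoid_morphism W_proj.
Proof.
rewrite /W_proj; split=> [|u v]; first by change (\pi_W 1 = W_one k n); rewrite !piE.
by change (\pi_W (u * v) = W_mul (\pi_W u) (\pi_W v)); rewrite !piE.
Qed.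
HB.instance Definition _ :=
  GRing.isMonoidMorphism.Build free W W_proj W_proj_monoid.

Lemma W_ind (Q : W -> Prop) :
  Q 1 -> (forall a u v, Q u -> Q v -> Q (a *: u + v)) ->
  (forall i u, Q u -> Q (x i * u)) -> forall w, Q w.
Proof.
move=> Q1 Qlin QX w; rewrite -[w]W_projK; move: (repr w) => u.
elim/free_ind: u => [|a u v Qu Qv|i u Qu]; first by rewrite rmorph1.
- by rewrite linearP; apply: Qlin.
- by rewrite rmorphM; apply: QX.
Qed.

Section UniversalProperty.
Variables (A : algType k) (y : 'I_n -> A).
Hypothesis yP : forall i j, i != j -> y i * y j + y j * y i = 1.

Lemma free_eval_ideal u : ideal_gen (@W_relator k n) u -> free_eval y u = 0.
Proof.
elim=> [|{}u v _ IHu _ IHv|a r b [i [j [ij ->]]]]; first exact: raddf0.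
- by rewrite raddfD /= IHu IHv addr0.
by apply: (rmorph_relator (f := free_eval y)); rewrite /= !free_evalX yP.
Qed.

Lemma free_eval_linear : linear (free_eval y).
Proof.
move=> a u v; rewrite raddfD /=; congr (_ + _).
rewrite -mul_malgC rmorphM /= {1}/free_eval mmapC /=.
by rewrite -scalerAl mul1r.
Qed.

Definition W_lift (w : W) : A := free_eval y (repr w).

Lemma W_lift_pi u : W_lift (W_proj u) = free_eval y u.
Proof.
apply/eqP; rewrite -subr_eq0 -raddfB; apply/eqP/free_eval_ideal/W_eqP.
by rewrite -/(W_proj _) W_projK.
Qed.

Lemma W_lift_linear : linear W_lift.
Proof.
move=> a u v; rewrite -[u]W_projK -[v]W_projK -W_proj_linear !W_lift_pi.
exact: free_eval_linear.
Qed.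

Lemma W_lift_monoid : monoid_morphism W_lift.
Proof.
split=> [|u v]; first by rewrite -(rmorph1 W_proj) W_lift_pi rmorph1.
by rewrite -[u]W_projK -[v]W_projK -rmorphM !W_lift_pi rmorphM.
Qed.

Lemma W_lift_gen i : W_lift (x i) = y i.
Proof. by rewrite W_lift_pi free_evalX. Qed.

End UniversalProperty.

(** Operators satisfying the relations, together with a base vector, give a linear
    map on W that intertwines left multiplication with the operators. *)
Section Representation.
Variables (V : lmodType k) (T : 'I_n -> {linear V -> V}) (v0 : V).
Hypothesis TP : forall i j v, i != j -> T i (T j v) + T j (T i v) = v.

Definition free_act (u : free) : V :=
  \sum_(m <- msupp u) u@_m *: foldr (fun i => T i) v0 (m : {fmonom 'I_n}).

Lemma free_actEw (d : {fset {fmonom 'I_n}}) u : (msupp u `<=` d)%fset ->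
  free_act u = \sum_(m <- d) u@_m *: foldr (fun i => T i) v0 (m : {fmonom 'I_n}).
Proof.
move=> le; rewrite /free_act; apply: big_fset_incl => // m _ /mcoeff_outdom ->.
by rewrite scale0r.
Qed.

Lemma free_act_linear : linear free_act.
Proof.
move=> a u v; pose d := (msupp (a *: u + v) `|` msupp u `|` msupp v)%fset.
rewrite !(@free_actEw d) ?fsubsetUr //; first last.
- by rewrite /d -fsetUA fsubsetUl.
- by rewrite /d fsetUAC fsubsetUr.
rewrite scaler_sumr -big_split /=; apply: eq_bigr => m _.
by rewrite mcoeffD mcoeffZ scalerDl scalerA.
Qed.
HB.instance Definition _ :=
  GRing.isLinear.Build k free V *:%R free_act free_act_linear.

Lemma free_actU c m : free_act << c *g m >> = c *: foldr (fun i => T i) v0 m.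
Proof. by rewrite (free_actEw msuppU_le) big_seq_fset1 mcoeffUU. Qed.

Lemma free_act1 : free_act 1 = v0.
Proof. by rewrite free_actU scale1r fm1. Qed.

Lemma free_actX i u : free_act (X i * u) = T i (free_act u).
Proof.
rewrite {1}[u]monalgE mulr_sumr raddf_sum [in RHS]/free_act raddf_sum /=.
apply: eq_bigr => m _.
by rewrite malgM_def fgmulUU mul1r free_actU fmM fmU /= linearZ.
Qed.

(** A relator kills every vector w.v0, hence so does any left multiple of it:
    induction on the left factor pushes one letter at a time through [free_act]. *)
Lemma free_act_ideal u : ideal_gen (@W_relator k n) u -> free_act u = 0.
Proof.
elim=> [|{}u v _ IHu _ IHv|a r b [i [j [ij ->]]]]; first exact: raddf0.
- by rewrite raddfD /= IHu IHv addr0.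
have : free_act ((X i * X j + X j * X i - 1) * b) = 0.
  by apply: act_relator (free_actX i) (free_actX j) _ => v; apply: TP.
rewrite -mulrA; move: (_ * b) => v v0'.
elim/free_ind: a => [|c u1 u2 IH1 IH2|l u1 IH]; first by rewrite mul1r.
- by rewrite lin_mull free_act_linear IH1 IH2 scaler0 addr0.
- by rewrite -mulrA free_actX IH linear0.
Qed.

Definition W_act (w : W) : V := free_act (repr w).

Lemma W_act_pi u : W_act (W_proj u) = free_act u.
Proof.
apply/eqP; rewrite -subr_eq0 -raddfB; apply/eqP/free_act_ideal/W_eqP.
by rewrite -/(W_proj _) W_projK.
Qed.

Lemma W_act_linear : linear W_act.
Proof.
move=> a u v; rewrite -[u]W_projK -[v]W_projK -W_proj_linear !W_act_pi.
exact: free_act_linear.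
Qed.

Lemma W_act1 : W_act 1 = v0.
Proof. by rewrite -(rmorph1 W_proj) W_act_pi free_act1. Qed.

Lemma W_actX i w : W_act (x i * w) = T i (W_act w).
Proof.
rewrite -[w]W_projK; move: (repr w) => u.
have -> : x i * W_proj u = W_proj (X i * u) by rewrite rmorphM.
by rewrite !W_act_pi free_actX.
Qed.

End Representation.
End Quotient.

End Presentation.
Import Presentation mpoly.

(** * The action of W on polynomials *)

Section LinearExtension.
Variables (k : fieldType) (n : nat) (V : lmodType k).
Implicit Types (f : 'X_{1..n} -> V) (p : {mpoly k[n]}) (m : 'X_{1..n}).

Definition mlin f p : V := \sum_(m <- msupp p) p@_m *: f m.

Lemma mlinEw f p d : (msize p <= d)%N ->
  mlin f p = \sum_(m : 'X_{1..n < d}) p@_m *: f m.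
Proof.
move=> le_pd; pose I : subFinType _ := 'X_{1..n < d}.
rewrite /mlin (big_mksub I) ?msupp_uniq //=; first last.
  by move=> x /msize_mdeg_lt /leq_trans; apply.
by rewrite big_rmcond //= => j /memN_msupp_eq0 ->; rewrite scale0r.
Qed.

Fact mlin_is_linear f : linear (mlin f).
Proof.
move=> a p q; pose d := maxn (msize (a *: p + q)) (maxn (msize p) (msize q)).
rewrite !(@mlinEw f _ d) ?leq_max ?leqnn ?orbT //.
rewrite scaler_sumr -big_split /=; apply: eq_bigr => m _.
by rewrite linearP /= scalerDl scalerA.
Qed.
HB.instance Definition _ f :=
  GRing.isLinear.Build k {mpoly k[n]} V *:%R (mlin f) (mlin_is_linear f).

Lemma mlinX f m : mlin f 'X_[m] = f m.
Proof. by rewrite /mlin msuppX big_seq1 mcoeffX eqxx scale1r. Qed.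

Lemma mpoly_lin_ext (F G : {linear {mpoly k[n]} -> V}) :
  (forall m, F 'X_[m] = G 'X_[m]) -> F =1 G.
Proof.
move=> FG p; rewrite [p]mpolyE !raddf_sum /=.
by apply: eq_bigr => m _; rewrite !linearZ /= FG.
Qed.

End LinearExtension.

Lemma mnm_ind n (Q : 'X_{1..n} -> Prop) :
  Q 0%MM -> (forall i a, Q a -> Q (U_(i) + a)%MM) -> forall a, Q a.
Proof.
move=> Q0 QS a; have [d] := ubnP (mdeg a); elim: d a => // d IH a.
move=> lta; have [->|] := eqVneq a 0%MM => //; rewrite -mdeg_eq0 mdegE sum_nat_eq0.
case/forallPn=> i; rewrite implyTb => ai0.
have E : a = (U_(i) + (a - U_(i)))%MM by rewrite addmC submK ?lep1mP.
rewrite E; apply: (QS); apply: IH.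
by move: lta; rewrite {1}E mdegD mdeg1.
Qed.

Section Operators.
Variables (k : fieldType) (n : nat).
Local Notation P := {mpoly k[n]}.
Implicit Types (p : P) (a : 'X_{1..n}) (i j : 'I_n).

(** The exponent of the sign picked up by the i-th variable of a skew polynomial
    ring when it moves past the variables of smaller index in a monomial. *)
Definition deg_below i a := (\sum_(l < n | (l < i)%N) a l)%N.

Lemma deg_belowU i j a : deg_below i (U_(j) + a)%MM = ((j < i) + deg_below i a)%N.
Proof.
rewrite /deg_below; under eq_bigr do rewrite mnmDE mnm1E.
rewrite big_split /=; congr (_ + _)%N.
rewrite big_mkcond (bigD1 j) //= eqxx big1 ?addn0; first by case: ltnP.
by move=> l; rewrite eq_sym => /negPf ->; case: ifP.
Qed.

Lemma deg_below0 i : deg_below i 0%MM = 0%N.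
Proof. by rewrite /deg_below big1 // => l _; rewrite mnm0E. Qed.

Lemma deg_below_var i j : deg_below i U_(j)%MM = (j < i)%N.
Proof. by rewrite -[U_(j)%MM]addm0 deg_belowU deg_below0 addn0. Qed.

(** [create i] is left multiplication by the i-th variable in the skew polynomial
    ring with anticommuting variables, written on ordered monomials.  [annih] is
    its odd derivation sending every variable to 1: in an ordered monomial the
    derivation of an even power of a variable vanishes, and that of an odd power
    lowers the exponent by one. *)
Definition create i : P -> P :=
  mlin (fun a => (-1) ^+ deg_below i a *: 'X_[U_(i) + a]).
Definition annih : P -> P :=
  mlin (fun a => \sum_j (if odd (a j) then
                           (-1) ^+ deg_below j a *: 'X_[a - U_(j)] else 0)).
HB.instance Definition _ i := GRing.Linear.on (create i).
HB.instance Definition _ := GRing.Linear.on annih.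

Lemma createX i a : create i 'X_[a] = (-1) ^+ deg_below i a *: 'X_[U_(i) + a].
Proof. exact: mlinX. Qed.

Lemma annihX a : annih 'X_[a] =
  \sum_j (if odd (a j) then (-1) ^+ deg_below j a *: 'X_[a - U_(j)] else 0).
Proof. exact: mlinX. Qed.

Lemma annih1 : annih 1 = 0.
Proof. by rewrite -mpolyX0 annihX big1 // => j _; rewrite mnm0E. Qed.

Lemma create1 i : create i 1 = 'X_i.
Proof.
by rewrite -mpolyX0 createX deg_below0 addm0 scale1r.
Qed.

Lemma create_anticomm i j p : i != j ->
  create i (create j p) + create j (create i p) = 0.
Proof.
move=> ij; rewrite -[LHS]/(((create i \o create j) \+ (create j \o create i)) p).
rewrite -[RHS]/((\0 : P -> P) p); apply: mpoly_lin_ext p => a /=.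
rewrite !createX !linearZ /= !createX !scalerA !deg_belowU !addmA [(U_(j) + _)%MM]addmC.
rewrite -scalerDl -[RHS](scale0r 'X_[U_(i) + U_(j) + a]); congr (_ *: _).
rewrite !exprD; case: (ltngtP j i) => [_|_|/val_inj E]; last by rewrite E eqxx in ij.
  by rewrite expr0 expr1 mulN1r mul1r mulrN mulrC addNr.
by rewrite expr0 expr1 mulN1r mul1r mulrN mulrC addrN.
Qed.

(** The Leibniz rule of an odd derivation applied to a product with the i-th
    variable, whose derivative is 1. *)
Lemma create_annih i p : create i (annih p) + annih (create i p) = p.
Proof.
rewrite -[LHS]/(((create i \o annih) \+ (annih \o create i)) p).
rewrite -[RHS]/(idfun p); apply: mpoly_lin_ext p => a /=.
rewrite createX annihX raddf_sum !linearZ /= annihX scaler_sumr -big_split /=.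
(* The terms with j != i cancel in pairs, and exactly one of the two terms with
   j = i is present, according to the parity of the exponent of i. *)
rewrite (bigD1 i) //= big1 ?addr0 => [|j ji].
  rewrite mnmDE mnm1E eqxx addnC addn1 /=; case: ifP => oa.
    have Ua : (U_(i) <= a)%MM by rewrite lep1mP; case: (a i) oa.
    rewrite scaler0 addr0 linearZ /= createX scalerA -exprD.
    rewrite -{1}(submK Ua) [(_ - _ + _)%MM]addmC deg_belowU ltnn add0n.
    by rewrite addnn -signr_odd odd_double expr0 scale1r addmC submK.
  rewrite linear0 add0r deg_belowU ltnn add0n scalerA -exprD addnn.
  by rewrite -signr_odd odd_double expr0 scale1r addmC addmK.
rewrite mnmDE mnm1E eq_sym (negPf ji) add0n; case: ifP => oa; last first.
  by rewrite linear0 scaler0 addr0.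
have Ua : (U_(j) <= a)%MM by rewrite lep1mP; case: (a j) oa.
rewrite linearZ /= createX !scalerA deg_belowU -addmBA //.
have -> : deg_below i a = ((j < i) + deg_below i (a - U_(j))%MM)%N.
  by rewrite -deg_belowU addmC submK.
rewrite -scalerDl.
rewrite !exprD; case: (ltngtP j i) => [_|_|/val_inj E]; last by rewrite E eqxx in ji.
  by rewrite expr0 expr1 mulN1r mul1r mulNr mulrC addrN scale0r.
by rewrite expr0 expr1 mulN1r mul1r mulrN mulrC addrN scale0r.
Qed.

(** By [create_annih] the square of [annih] commutes with every [create i], and it
    vanishes at 1, from which the [create i] generate all monomials. *)
Lemma annih_annih p : annih (annih p) = 0.
Proof.
rewrite -[LHS]/((annih \o annih) p) -[RHS]/((\0 : P -> P) p).
apply: mpoly_lin_ext p => a /=; elim/mnm_ind: a => [|i a IH].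
  by rewrite mpolyX0 annih1 linear0.
suff E q : annih (annih (create i q)) = create i (annih (annih q)).
  move: (E 'X_[a]); rewrite IH linear0 createX !linearZ /= => /eqP.
  by rewrite scaler_eq0 signr_eq0 => /eqP.
have D q' : annih (create i q') = q' - create i (annih q').
  by apply/eqP; rewrite eq_sym subr_eq addrC create_annih.
by rewrite D linearB /= D opprB addrCA subrr addr0.
Qed.

(** Only the cross terms of [create] and [annih] survive in the anticommutator of
    two such operators; each of the two contributes one half. *)
Definition act_gen i p : P := create i p + 2%:R^-1 *: annih p.

Fact act_gen_is_linear i : linear (act_gen i).
Proof.
move=> a p q; rewrite /act_gen !linearP /= !scalerDr addrACA.
by congr (_ + _ + _); rewrite !scalerA mulrC.
Qed.
HB.instance Definition _ i :=
  GRing.isLinear.Build k P P *:%R (act_gen i) (act_gen_is_linear i).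

Lemma act_genP i j p : 2%:R != 0 :> k -> i != j ->
  act_gen i (act_gen j p) + act_gen j (act_gen i p) = p.
Proof.
move=> k2 ij; rewrite /act_gen !linearD !linearZ /= !annih_annih !scaler0 !addr0.
transitivity ((create i (create j p) + create j (create i p)) + 2%:R^-1 *:
    ((create i (annih p) + annih (create i p))
     + (create j (annih p) + annih (create j p)))).
  by rewrite !scalerDr; ring.
rewrite create_anticomm // !create_annih add0r -mulr2n -scaler_nat scalerA.
by rewrite mulVf ?scale1r.
Qed.

End Operators.

(** * Leading monomials *)

Section SizeBounds.
Variables (k : fieldType) (n : nat).
Local Notation P := {mpoly k[n]}.
Implicit Types (p q : P) (a b c : 'X_{1..n}) (i j : 'I_n).

Lemma msize_mlin f d p :
  (forall a, msize (f a : P) <= (mdeg a).+1 + d)%N ->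
  (msize (mlin f p) <= msize p + d)%N.
Proof.
move=> fd; rewrite /mlin big_seq; elim/big_rec: _ => [|a q ap IH].
  by rewrite msize0.
apply: leq_trans (msizeD_le _ _) _; rewrite geq_max IH andbT.
apply: leq_trans (mmeasureZ_le _ _ _) _; apply: leq_trans (fd a) _.
by rewrite leq_add2r msize_mdeg_lt.
Qed.

Lemma msize_sign e p : msize ((-1) ^+ e *: p) = msize p.
Proof. by rewrite mmeasureZ // signr_eq0. Qed.

Lemma msize_create i p : (msize (create i p) <= (msize p).+1)%N.
Proof.
rewrite -addn1; apply: msize_mlin => a.
by rewrite msize_sign msizeX mdegD mdeg1 addn1.
Qed.

Lemma msize_annih p : (msize (annih p) <= msize p)%N.
Proof.
rewrite -[X in (_ <= X)%N]addn0; apply: msize_mlin => a; rewrite addn0.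
elim/big_rec: _ => [|j q _ IH]; first by rewrite msize0.
apply: leq_trans (msizeD_le _ _) _; rewrite geq_max IH andbT.
by case: ifP => _; rewrite ?msize0 // msize_sign msizeX ltnS mdegB.
Qed.

(** As [msize] is the degree plus one, the error has total degree below that of a: it
    touches no coefficient at a or above it in the degree-lexicographic order. *)
Definition leads p a : Prop :=
  exists e : bool, (msize (p - (-1) ^+ e *: 'X_[a]) <= mdeg a)%N.

Lemma leads_split p a : leads p a ->
  exists e : bool, exists2 q, p = (-1) ^+ e *: 'X_[a] + q & (msize q <= mdeg a)%N.
Proof. by case=> e ?; exists e, (p - (-1) ^+ e *: 'X_[a]); rewrite // addrC subrK. Qed.

Lemma mcoeff_big p c : (msize p <= mdeg c)%N -> p@_c = 0.
Proof. by move=> h; apply/eqP; rewrite mcoeff_eq0 msize_mdeg_ge. Qed.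

Lemma leads_neq0 p a : leads p a -> p@_a != 0.
Proof.
case/leads_split=> e [q -> qa]; rewrite mcoeffD mcoeffZ mcoeffX eqxx mulr1.
by rewrite (mcoeff_big qa) addr0 signr_eq0.
Qed.

Lemma leads_gt p a c : leads p a -> (a < c)%O -> p@_c = 0.
Proof.
case/leads_split=> e [q -> qa] ac; rewrite mcoeffD mcoeffZ mcoeffX lt_eqF //.
by rewrite mulr0 add0r mcoeff_big // (leq_trans qa) // lemc_mdeg // ltW.
Qed.

Lemma leads_msize p a : leads p a -> (msize p <= (mdeg a).+1)%N.
Proof.
case/leads_split=> e [q -> qa]; apply: leq_trans (msizeD_le _ _) _.
by rewrite geq_max msize_sign msizeX leqnn /= leqW.
Qed.

(** [create i] raises the degree by one and is monomial up to sign, while [annih]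
    does not raise the degree. *)
Lemma leads_act i p a : leads p a -> leads (act_gen i p) (U_(i) + a).
Proof.
move=> pa; have pS := leads_msize pa; case/leads_split: pa => e [q Ep qa].
exists (odd (e + deg_below i a)); rewrite signr_odd exprD.
rewrite /act_gen {1}Ep linearD linearZ /= createX scalerA -!addrA addrC -!addrA.
rewrite addNr addr0 mdegD mdeg1 add1n; apply: leq_trans (msizeD_le _ _) _.
rewrite geq_max (leq_trans (msize_create _ _)) //=.
by apply: leq_trans (mmeasureZ_le _ _ _) _; apply: leq_trans (msize_annih _) _.
Qed.

End SizeBounds.

Section Words.
Variable n : nat.
Implicit Types (r : seq 'I_n) (a : 'X_{1..n}).

Definition content r : 'X_{1..n} := (\sum_(i <- r) U_(i))%MM.

Lemma contentE r i : content r i = count_mem i r.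
Proof.
rewrite /content mnm_sumE; elim: r => [|j r IH]; first by rewrite big_nil.
by rewrite big_cons IH mnm1E.
Qed.

Definition ascending r := sorted leq (map val r).

Definition word a : seq 'I_n :=
  sort (relpre val leq) (flatten [seq nseq (a i) i | i <- enum 'I_n]).

Lemma word_ascending a : ascending (word a).
Proof. by rewrite /ascending sorted_map sort_sorted // => i j; apply: leq_total. Qed.

Lemma word_content a : content (word a) = a.
Proof.
rewrite /content (perm_big _ (permEl (perm_sort _ _))) big_flatten big_map big_enum /=.
rewrite [RHS]multinomUE_id.
by apply: eq_bigr => i _; rewrite big_nseq /mnm_muln Monoid.iteropE.
Qed.

Lemma content_word r : ascending r -> word (content r) = r.
Proof.
move=> ar; apply: (inj_map val_inj); apply: (sorted_eq leq_trans anti_leq).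
- exact: word_ascending.
- by [].
- by apply/perm_map/allP => i _ /=; rewrite -!contentE word_content.
Qed.

End Words.

(** * The symbol map and the degree on W *)

Section Degree.
Variables (k : fieldType) (n : nat).
Hypothesis k2 : 2%:R != 0 :> k.
Local Notation P := {mpoly k[n]}.
Local Notation W := (W k n).
Local Notation x := (W_gen k).
Implicit Types (p q : P) (a b : 'X_{1..n}) (i j : 'I_n) (r : seq 'I_n) (u v w : W).

Let act_genP' i j (p : P) : i != j ->
  (act_gen i : {linear P -> P}) ((act_gen j : {linear P -> P}) p)
  + (act_gen j : {linear P -> P}) ((act_gen i : {linear P -> P}) p) = p.
Proof. exact: act_genP. Qed.

(** The symbol of w is w applied to the polynomial 1.  The two equations determine it,
    and nothing else about its construction is used. *)
Lemma symb_exists : {symb : {linear W -> P} |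
  symb 1 = 1 & forall i w, symb (x i * w) = act_gen i (symb w)}.
Proof.
pose f : W -> P := W_act (fun i => act_gen i : {linear P -> P}) 1.
pose lf := GRing.isLinear.Build k W P *:%R f (W_act_linear _ act_genP').
pose F : {linear W -> P} := HB.pack f lf.
by exists F => [|i w]; [exact: W_act1 act_genP' | exact: W_actX act_genP' _ _].
Qed.

Definition symb : {linear W -> P} := s2val symb_exists.

Lemma symb1 : symb 1 = 1. Proof. by rewrite /symb; case: symb_exists. Qed.

Lemma symbX i w : symb (x i * w) = act_gen i (symb w).
Proof. by rewrite /symb; case: symb_exists. Qed.

Definition xword r : W := \prod_(i <- r) x i.
(** Ordered monomials.  Composing [symb] after their linear extension [sect] is not
    the identity but is triangular, with signs on the diagonal. *)
Definition mono a : W := xword (word a).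
Definition sect : P -> W := mlin mono.
HB.instance Definition _ := GRing.Linear.on sect.

Lemma xword_cons i r : xword (i :: r) = x i * xword r.
Proof. by rewrite /xword big_cons. Qed.

Lemma leads_word r w a : leads (symb w) a -> leads (symb (xword r * w)) (content r + a).
Proof.
move=> wa; elim: r => [|i r IH].
  by rewrite /xword /content !big_nil mul1r add0m.
by rewrite xword_cons -mulrA symbX /content big_cons -addmA; apply: leads_act.
Qed.

Lemma leads1 : leads (symb 1) 0%MM.
Proof. by rewrite symb1; exists false; rewrite expr0 scale1r mpolyX0 subrr msize0. Qed.

Lemma leads_mono a b : leads (symb (mono a * mono b)) (a + b).
Proof.
rewrite -{2}(word_content a); apply: leads_word; rewrite -[mono b]mulr1.
by rewrite -{2}(word_content b) -[content _]addm0; apply/leads_word/leads1.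
Qed.

Lemma sectM p q : sect p * sect q =
  \sum_(a <- msupp p) \sum_(b <- msupp q) (p@_a * q@_b) *: (mono a * mono b).
Proof.
rewrite /sect /mlin mulr_suml; apply: eq_bigr => a _; rewrite mulr_sumr.
by apply: eq_bigr => b _; rewrite -scalerAl -scalerAr scalerA.
Qed.

(** The product of ordered monomials a and b has symbol led by a + b, and the order
    on monomials is compatible with addition, so only the two leading monomials
    contribute at the sum of the leading monomials: the argument that a polynomial
    ring is a domain, with signs. *)
Lemma symb_sectM_lead p q : p != 0 -> q != 0 ->
  (symb (sect p * sect q))@_(mlead p + mlead q) != 0.
Proof.
move=> p0 q0; rewrite sectM !raddf_sum /=.
have lt_lead a b : a \in msupp p -> b \in msupp q -> (a, b) != (mlead p, mlead q) ->
    ((a + b)%MM < (mlead p + mlead q)%MM)%O.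
  move=> /msupp_le_mlead ap /msupp_le_mlead bq; rewrite xpair_eqE.
  have [->|na] := eqVneq a (mlead p) => /= nb.
    by apply: lemc_lt_add => //; rewrite lt_neqAle nb.
  by apply: ltmc_le_add => //; rewrite lt_neqAle na.
rewrite (bigD1_seq (mlead p)) ?mlead_supp ?msupp_uniq //=.
rewrite [X in _ + X]big_seq_cond [X in _ + X]big1 => [|a].
  rewrite addr0 !raddf_sum /= (bigD1_seq (mlead q)) ?mlead_supp ?msupp_uniq //=.
  rewrite big_seq_cond big1 => [|b /andP[bq nb]].
    rewrite addr0 linearZ mcoeffZ !mulf_neq0 ?mleadc_eq0 //.
    exact/leads_neq0/leads_mono.
  rewrite linearZ mcoeffZ (leads_gt (leads_mono _ _)) ?mulr0 // lt_lead //.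
    exact: mlead_supp.
  by rewrite xpair_eqE negb_and nb orbT.
case/andP=> ap na; rewrite !raddf_sum big_seq big1 // => b bq /=.
rewrite linearZ mcoeffZ (leads_gt (leads_mono _ _)) ?mulr0 // lt_lead //.
by rewrite xpair_eqE negb_and na.
Qed.

Lemma symb_sectM_msize p q :
  (msize (symb (sect p * sect q)%R) <= (msize p + msize q).-1)%N.
Proof.
rewrite sectM raddf_sum /= big_seq; elim/big_rec: _ => [|a v ap IH].
  by rewrite msize0.
apply: leq_trans (msizeD_le _ _) _; rewrite geq_max IH andbT.
rewrite raddf_sum /= big_seq; elim/big_rec: _ => [|b {IH}v bq IH].
  by rewrite msize0.
apply: leq_trans (msizeD_le _ _) _; rewrite geq_max IH andbT.
rewrite linearZ /=; apply: leq_trans (mmeasureZ_le _ _ _) _.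
apply: leq_trans (leads_msize (leads_mono a b)) _; rewrite mdegD.
by move: (msize_mdeg_lt ap) (msize_mdeg_lt bq); lia.
Qed.

Inductive xspan (Q : seq 'I_n -> Prop) : W -> Prop :=
| xspan0 : xspan Q 0
| xspanD u v : xspan Q u -> xspan Q v -> xspan Q (u + v)
| xspanZ c r : Q r -> xspan Q (c *: xword r).

Lemma xspan_lin Q c u v : xspan Q u -> xspan Q v -> xspan Q (c *: u + v).
Proof.
move=> Qu Qv; apply: xspanD => //; elim: Qu => [|u1 u2 _ IH1 _ IH2|d r Qr].
- by rewrite scaler0; apply: xspan0.
- by rewrite scalerDr; apply: xspanD.
- by rewrite scalerA; apply: xspanZ.
Qed.

Definition above (m : nat) r := path leq m (map val r).

(** Ordered words span a left ideal: x_i is either placed in front, or moved past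
    the smaller first letter j at the cost of a shorter word.  The lower bound m
    is what allows j to be put back in front of the reordered remainder. *)
Lemma xspan_mul_above m i r : above m r -> (m <= i)%N -> xspan (above m) (x i * xword r).
Proof.
elim: r m => [|j r IH] m /=.
  by move=> _ mi; rewrite -xword_cons -[xword _]scale1r; apply: xspanZ; rewrite /above /= mi.
move=> /andP[mj jr] mi; have [ij|ji] := leqP i j.
  by rewrite -xword_cons -[xword _]scale1r; apply: xspanZ; rewrite /above /= mi ij.
have nij : i != j by apply: contraTneq ji => ->; rewrite ltnn.
have -> : x i * xword (j :: r) = -1 *: (x j * (x i * xword r)) + xword r.
  apply/eqP; rewrite xword_cons scaleN1r addrC eq_sym subr_eq.
  by rewrite !mulrA -mulrDl W_genP // mul1r.
have mr : above m r by apply: path_le jr => //; apply: leq_trans.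
apply: xspan_lin; last by rewrite -[xword r]scale1r; apply: xspanZ.
elim: (IH j jr (ltnW ji)) => [|u v _ IHu _ IHv|c s js].
- by rewrite mulr0; apply: xspan0.
- by rewrite mulrDr; apply: xspanD.
- by rewrite -scalerAr -xword_cons; apply: xspanZ; rewrite /above /= mj.
Qed.

Lemma sect_onto w : exists p, w = sect p.
Proof.
have : xspan (above 0) w.
  elim/W_ind: w => [|c u v Su Sv|i u Su].
  - have -> : 1 = 1 *: xword [::] by rewrite /xword big_nil scale1r.
    exact: xspanZ.
  - exact: xspan_lin.
  - elim: Su => [|u1 u2 _ IH1 _ IH2|c r Qr].
    + by rewrite mulr0; apply: xspan0.
    + by rewrite mulrDr; apply: xspanD.
    + by rewrite -scalerAr -[_ *: _]addr0; apply: xspan_lin (xspan0 _); apply: xspan_mul_above.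
elim=> [|u v _ [p ->] _ [q ->]|c r /path_sorted ar].
- by exists 0; rewrite linear0.
- by exists (p + q); rewrite linearD.
- by exists (c *: 'X_[content r]); rewrite linearZ /= /sect mlinX /mono content_word.
Qed.

Lemma mono0 : mono 0%MM = 1.
Proof.
have E : word (content [::]) = [::] :> seq 'I_n by rewrite content_word.
by move: E; rewrite /mono {1}/content big_nil => ->; rewrite /xword big_nil.
Qed.

Lemma sect1 : sect 1 = 1.
Proof. by rewrite -mpolyX0 /sect mlinX mono0. Qed.

Lemma sect_msize p : msize (symb (sect p)) = msize p.
Proof.
have [->|p0] := eqVneq p 0; first by rewrite !linear0.
apply/eqP; rewrite eqn_leq -{1}[sect p]mulr1 -sect1.
rewrite (leq_trans (symb_sectM_msize _ _)) ?msize1 ?addn1 //=.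
have := symb_sectM_lead p0 (oner_neq0 _).
rewrite sect1 mulr1 mlead1 addm0 -mcoeff_msupp => /msize_mdeg_lt.
by rewrite -ltnS -(mlead_deg p0).
Qed.

(** The degree plus one, and 0 at 0, as for the size of a polynomial. *)
Definition wsize w : nat := msize (symb w).

Lemma wsize_eq0 w : (wsize w == 0%N) = (w == 0).
Proof.
apply/eqP/eqP=> [|->]; last by rewrite /wsize linear0 msize0.
have [p ->] := sect_onto w; rewrite /wsize sect_msize => /eqP.
by rewrite msize_poly_eq0 => /eqP ->; rewrite linear0.
Qed.

Lemma symb_inj : injective symb.
Proof.
move=> u v uv; apply/eqP; rewrite -subr_eq0 -wsize_eq0 /wsize linearB /= uv subrr.
by rewrite msize0.
Qed.

Lemma wsizeM u v : u != 0 -> v != 0 -> wsize (u * v) = (wsize u + wsize v).-1.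
Proof.
have [[p Eu] [q Ev]] := (sect_onto u, sect_onto v).
have Du : wsize u = msize p by rewrite Eu /wsize sect_msize.
have Dv : wsize v = msize q by rewrite Ev /wsize sect_msize.
rewrite -!wsize_eq0 Du Dv !msize_poly_eq0 Eu Ev => p0 q0.
apply/eqP; rewrite eqn_leq symb_sectM_msize /=.
have := symb_sectM_lead p0 q0; rewrite -mcoeff_msupp => /msize_mdeg_lt.
by rewrite mdegD -(mlead_deg p0) -(mlead_deg q0) /= addnS.
Qed.

Lemma wsizeD u v : (wsize (u + v)%R <= maxn (wsize u) (wsize v))%N.
Proof. by rewrite /wsize linearD msizeD_le. Qed.

Lemma wsizeZ c u : (wsize (c *: u) <= wsize u)%N.
Proof. by rewrite /wsize linearZ mmeasureZ_le. Qed.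

Lemma wsizeZ_eq c u : c != 0 -> wsize (c *: u) = wsize u.
Proof. by move=> c0; rewrite /wsize linearZ mmeasureZ. Qed.

Lemma wsize_le1 w : (wsize w <= 1)%N -> exists c, w = c%:A.
Proof.
move/msize1_polyC => E; exists (symb w)@_0; apply: symb_inj.
by rewrite linearZ /= symb1 alg_mpolyC.
Qed.

Lemma symb_gen i : symb (x i) = 'X_i.
Proof. by rewrite -[x i]mulr1 symbX symb1 /act_gen create1 annih1 scaler0 addr0. Qed.

Lemma wsize_gen i : wsize (x i) = 2%N.
Proof. by rewrite /wsize symb_gen msizeX mdeg1. Qed.

Lemma wsize_1 : wsize 1 = 1%N.
Proof. by rewrite /wsize symb1 msize1. Qed.

End Degree.

(** * Twisting by anticommuting elements *)

Section Central.
Variable R : nzRingType.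
Implicit Types z w : R.

Definition central z := forall w, z * w = w * z.

Lemma central0 : central 0. Proof. by move=> w; rewrite mul0r mulr0. Qed.
Lemma central1 : central 1. Proof. by move=> w; rewrite mul1r mulr1. Qed.
Lemma centralD z1 z2 : central z1 -> central z2 -> central (z1 + z2).
Proof. by move=> c1 c2 w; rewrite mulrDl mulrDr c1 c2. Qed.
Lemma centralM z1 z2 : central z1 -> central z2 -> central (z1 * z2).
Proof. by move=> c1 c2 w; rewrite -mulrA c2 mulrA c1 mulrA. Qed.

End Central.

Lemma centralZ (k : fieldType) (A : algType k) c (z : A) : central z -> central (c *: z).
Proof. by move=> cz w; rewrite -scalerAl cz scalerAr. Qed.

Section Signs.
Variable n : nat.
Implicit Types (r : seq 'I_n) (S T : {set 'I_n}).

(** The parity of the number of letters of r other than i decides whether y_i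
    commutes or anticommutes with y_r to leading order. *)
Definition twist r (i : 'I_n) : nat := count (predC1 i) r.

Lemma twist_enum S i : odd (twist (enum S) i) = odd #|S| (+) (i \in S).
Proof.
rewrite cardE -(count_predC (pred1 i)) (count_uniq_mem i (enum_uniq S)) mem_enum.
rewrite oddD oddb addbAC addbb addFb.
by congr (odd _); apply: eq_count.
Qed.

(** If two distinct sets have the same sign pattern, they are complementary with
    cardinals of opposite parity, so that n is odd. *)
Lemma twist_inj S T : ~~ odd n ->
  (forall i, odd (twist (enum S) i) = odd (twist (enum T) i)) -> S = T.
Proof.
move=> n_even ST; have {}ST i : (i \in S) = (i \in T) (+) (odd #|S| (+) odd #|T|).
  move: (ST i); rewrite !twist_enum.
  by case: (odd #|S|); case: (odd #|T|); case: (i \in S); case: (i \in T).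
case E: (odd #|S| (+) odd #|T|); last first.
  by apply/setP => i; rewrite ST E addbF.
have TS : S = ~: T by apply/setP => i; rewrite ST E addbT inE.
suff : odd n by rewrite (negPf n_even).
by rewrite -[n in odd n]card_ord -(cardsC T) -TS oddD addbC.
Qed.

End Signs.

Section Rigidity.
Variables (k : fieldType) (n : nat).
Hypothesis k2 : 2%:R != 0 :> k.
Local Notation W := (W k n).
Local Notation x := (W_gen k).
Local Notation wsize := (@wsize k n k2).
Implicit Types (i j : 'I_n) (r : seq 'I_n) (u v w : W) (S T : {set 'I_n}).

Lemma wsize0 : wsize 0 = 0%N.
Proof. by apply/eqP; rewrite wsize_eq0. Qed.

Lemma wsizeM_le u v : (wsize (u * v)%R <= (wsize u + wsize v).-1)%N.
Proof.
have [->|u0] := eqVneq u 0; first by rewrite mul0r wsize0.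
have [->|v0] := eqVneq v 0; first by rewrite mulr0 wsize0.
by rewrite wsizeM.
Qed.

Lemma wsize_gt0 u : (0 < wsize u)%N = (u != 0).
Proof. by rewrite lt0n wsize_eq0. Qed.

Lemma wsizeD_lt u v m : (wsize u < m)%N -> (wsize v < m)%N -> (wsize (u + v)%R < m)%N.
Proof. by move=> um vm; apply: leq_ltn_trans (wsizeD _ _ _) _; rewrite gtn_max um. Qed.

Lemma wsizeZ_lt c u m : (wsize u < m)%N -> (wsize (c *: u) < m)%N.
Proof. exact/leq_ltn_trans/wsizeZ. Qed.

Lemma wsize_sum_lt (I : finType) (Q : pred I) (F : I -> W) m : (0 < m)%N ->
  (forall l, Q l -> (wsize (F l)%R < m)%N) -> (wsize (\sum_(l | Q l) F l)%R < m)%N.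
Proof.
move=> m0 FQ; elim/big_rec: _ => [|l v Ql IH]; first by rewrite wsize0.
by apply: wsizeD_lt => //; apply: FQ.
Qed.

Section Twisting.
Variable y : 'I_n -> W.
Hypothesis yP : forall i j, i != j -> y i * y j + y j * y i = 1.
Hypothesis y_size : forall i, (1 < wsize (y i))%N.

Definition yword r : W := \prod_(i <- r) y i.

Lemma y_neq0 i : y i != 0.
Proof. by rewrite -wsize_gt0 ltnW. Qed.

Lemma yword_size r : (size r < wsize (yword r))%N.
Proof.
elim: r => [|j r IH]; first by rewrite /yword big_nil wsize_1.
have r0 : yword r != 0 by rewrite -wsize_gt0 (leq_ltn_trans _ IH).
rewrite /yword big_cons wsizeM ?y_neq0 //=; move: (y_size j) IH.
by rewrite -/(yword r); lia.
Qed.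

Lemma yword_neq0 r : yword r != 0.
Proof. by rewrite -wsize_gt0 (leq_ltn_trans _ (yword_size r)). Qed.

(** Each exchange of y_i with another letter gives a sign and replaces two factors
    of positive degree by the constant 1. *)
Lemma yword_twist r i :
  (wsize (yword r * y i - (-1) ^+ twist r i *: (y i * yword r))%R
     < (wsize (yword r) + wsize (y i)).-1)%N.
Proof.
elim: r => [|j r IH].
  rewrite /yword big_nil mul1r mulr1 /twist /= scale1r subrr wsize0 wsize_1 add1n /=.
  exact: ltnW.
set L := (_ - _) in IH; rewrite /yword big_cons -/(yword r) /twist /= -/(twist r i).
rewrite wsizeM ?y_neq0 ?yword_neq0 //.
have [ji|ji] /= := eqVneq j i.
  rewrite ji add0n.
  have -> : y i * yword r * y i - (-1) ^+ twist r i *: (y i * (y i * yword r)) = y i * L.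
    by rewrite /L mulrBr -scalerAr -mulrA.
  by apply: leq_ltn_trans (wsizeM_le _ _) _; move: (y_size i) IH; lia.
have -> : y j * yword r * y i - (-1) ^+ (1 + twist r i) *: (y i * (y j * yword r))
    = y j * L + (-1) ^+ twist r i *: yword r.
  rewrite /L exprD expr1 mulN1r scaleNr opprK mulrBr -scalerAr -[RHS]addrA -mulrA; congr (_ + _).
  rewrite -scalerN -scalerDr; congr (_ *: _).
  apply/eqP; rewrite addrC eq_sym subr_eq !mulrA -mulrDl yP ?mul1r //.
  by rewrite eq_sym.
apply: wsizeD_lt; last apply: wsizeZ_lt.
  by apply: leq_ltn_trans (wsizeM_le _ _) _; move: (y_size j) IH; lia.
by move: (y_size j) (y_size i) (yword_size r); lia.
Qed.

Variable z : {set 'I_n} -> W.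
Hypothesis zC : forall S, central (z S).

(** Suppose the sum has smaller degree than its largest term t(S0).  Then so has
    the partial sum over the S whose sign pattern agrees with that of S0 on a list r,
    by induction on r: adding y_i v and the suitably signed v y_i doubles, up to
    lower degree, the terms agreeing with S0 at i and removes the others, and the
    factor y_i can be cancelled because degrees are additive.  For r the full list
    only t(S0) is left, a contradiction. *)
Lemma wsize_term_le (n_even : ~~ odd n) T :
  (wsize (z T * yword (enum T))%R <= wsize (\sum_S z S * yword (enum S))%R)%N.
Proof.
pose t S := z S * yword (enum S).
have [S0 _ maxS0] := @arg_maxnP _ T predT (fun S => wsize (t S)) isT.
apply: leq_trans (maxS0 T isT) _; rewrite -/(t _) leqNgt; apply/negP.
set m := wsize (t S0) => lt_m.
have m0 : (0 < m)%N by apply: leq_ltn_trans lt_m.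
pose Q r S := all (fun i => odd (twist (enum S) i) == odd (twist (enum S0) i)) r.
suff main r : (wsize (\sum_(S | Q r S) t S)%R < m)%N.
  have := main (enum 'I_n); rewrite (big_pred1 S0) ?ltnn // => S.
  apply/allP/eqP => [QS|-> i _ //]; apply: twist_inj => // i.
  by apply/eqP/QS; rewrite mem_enum.
elim: r => [|i r IH]; first by rewrite big_mkcond /=.
set v := \sum_(S | _) t S in IH; set v' := \sum_(S | _) _.
pose e := twist (enum S0) i.
(* L S is the lower-order error made when y i is exchanged with the word of S. *)
pose L S := yword (enum S) * y i - (-1) ^+ twist (enum S) i *: (y i * yword (enum S)).
have E : 2%:R *: (y i * v') = (y i * v + (-1) ^+ e *: (v * y i))
    - (-1) ^+ e *: \sum_(S | Q r S) z S * L S.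
  rewrite /v mulr_suml mulr_sumr !scaler_sumr -big_split -sumrB /=.
  rewrite /v' mulr_sumr scaler_sumr big_mkcond [RHS]big_mkcond /=.
  apply: eq_bigr => S _; case: (Q r S); rewrite ?andbF //= andbT.
  rewrite /L mulrBr scalerBr opprB /t -[z S * _ * y i]mulrA.
  rewrite addrACA subrr addr0.
  rewrite -scalerAr scalerA -exprD [y i * (z S * _)]mulrA -(zC S (y i)) -mulrA.
  rewrite -[X in X + _]scale1r -scalerDl -signr_odd oddD -/e.
  case: ifP => [/eqP ->|]; first by rewrite addbb expr0.
  by case: (odd (twist _ i)); case: (odd e) => //= _; rewrite expr1 subrr scale0r.
have lt_v' : (wsize (y i * v')%R < (wsize (y i) + m).-1)%N.
  have -> : y i * v' = 2%:R^-1 *: (2%:R *: (y i * v')) by rewrite scalerA mulVf ?scale1r.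
  apply: wsizeZ_lt; rewrite E -scaleNr; apply: wsizeD_lt; last apply: wsizeZ_lt.
    apply: wsizeD_lt; last apply: wsizeZ_lt.
      by apply: leq_ltn_trans (wsizeM_le _ _) _; move: (y_size i) IH; lia.
    by apply: leq_ltn_trans (wsizeM_le _ _) _; move: (y_size i) IH; lia.
  apply: wsize_sum_lt => [|S _]; first by move: (y_size i); lia.
  have [->|z0] := eqVneq (z S) 0.
    by rewrite mul0r wsize0; move: (y_size i); lia.
  apply: leq_ltn_trans (wsizeM_le _ _) _.
  have := maxS0 S isT; rewrite -/m /t wsizeM ?yword_neq0 //.
  have := yword_twist (enum S) i; rewrite -/(L S) -wsize_gt0 in z0 *.
  by move: (y_size i) (yword_size (enum S)) z0; lia.
have [->|v0] := eqVneq v' 0; first by rewrite wsize0.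
by move: lt_v'; rewrite wsizeM ?y_neq0 //; move: (y_size i) m0; lia.
Qed.

End Twisting.
End Rigidity.

(** * W over its centre *)

Section CentralBasis.
Variables (k : fieldType) (n : nat).
Local Notation W := (W k n).
Local Notation x := (W_gen k).
Local Notation xword := (@xword k n).
Implicit Types (i j : 'I_n) (r : seq 'I_n) (u v w : W) (S T : {set 'I_n}).

Lemma central_gen2 i : central (x i * x i).
Proof.
elim/W_ind => [|c u v cu cv|j u cu]; first by rewrite mulr1 mul1r.
  by rewrite mulrDr mulrDl -scalerAr -scalerAl cu cv.
suff xij : x i * x i * x j = x j * (x i * x i) by rewrite mulrA xij -mulrA cu mulrA.
have [->|ij] := eqVneq i j; first by rewrite mulrA.
have -> : x i * x i * x j = x i - x i * x j * x i.
  by rewrite -mulrA -[x i * x j in LHS](addrK (x j * x i)) W_genP // mulrBr mulr1 mulrA.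
by rewrite mulrA -[x j * x i](addrK (x i * x j)) W_genP 1?eq_sym // mulrBl mul1r.
Qed.

(** Repeated letters of an ascending word are adjacent, so they pair off into
    central squares. *)
Lemma xword_reduce r : ascending r -> exists z s,
  [/\ central z, xword r = z * xword s, sorted ltn (map val s) & {subset s <= r}].
Proof.
elim: r => [|i r IH] ar; first by exists 1, [::]; split; rewrite ?mul1r //; apply: central1.
have {IH}[z [s [cz Er ss sr]]] := IH (path_sorted ar).
have is_ j : j \in s -> (i <= j)%N.
  move=> /sr jr; have /allP := order_path_min leq_trans ar; apply.
  exact: map_f.
case: s Er ss sr is_ => [|j s] Er ss sr is_.
  exists z, [:: i]; split=> //; last by move=> j; rewrite !inE => ->.
  by rewrite !xword_cons Er !mulrA cz.
have [ij|ij] := eqVneq i j.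
  exists (x i * x i * z), s; split.
  - by apply: centralM => //; apply: central_gen2.
  - by rewrite xword_cons Er xword_cons -ij cz -[RHS]mulrA cz !mulrA.
  - exact: path_sorted ss.
  - by move=> l ls; rewrite inE sr ?orbT // inE ls orbT.
exists z, [:: i, j & s]; split=> //.
- by rewrite xword_cons Er (xword_cons _ i (j :: s)) !mulrA cz.
- by rewrite /= in ss *; rewrite ss andbT ltn_neqAle ij is_ ?mem_head.
- by move=> l; rewrite inE => /predU1P[->|/sr lr]; rewrite inE ?eqxx ?lr ?orbT.
Qed.

Lemma enum_ltn_sorted S : sorted ltn (map val (enum S)).
Proof.
rewrite sorted_map /enum_mem; apply: sorted_filter => [l1 l2 l3|]; first exact: ltn_trans.
by rewrite -enumT -sorted_map val_enum_ord iota_ltn_sorted.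
Qed.

Lemma central_decomposition w : exists2 z : {set 'I_n} -> W,
  forall S, central (z S) & w = \sum_S z S * xword (enum S).
Proof.
have [p ->] := sect_onto w; rewrite /sect /mlin.
elim/big_rec: _ => [|a u _ [z cz ->]].
  exists (fun=> 0) => [S|]; first exact: central0.
  by rewrite big1 // => S _; rewrite mul0r.
have [c [s [cc Ec ss _]]] := xword_reduce (word_ascending a).
have Es : s = enum [set i in s].
  apply: (inj_map val_inj); apply: (irr_sorted_eq ltn_trans ltnn) => //.
    exact: enum_ltn_sorted.
  by apply: eq_mem_map => i; rewrite mem_enum inE.
exists (fun S => (if S == [set i in s] then p@_a *: c else 0) + z S) => [S|].
  by apply: centralD => //; case: ifP => _; [apply: centralZ | apply: central0].
under [RHS]eq_bigr do rewrite mulrDl; rewrite big_split /=; congr (_ + _).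
rewrite (bigD1 [set i in s]) //= eqxx big1 ?addr0 => [|S /negPf ->]; last by rewrite mul0r.
by rewrite -Es -scalerAl /mono Ec.
Qed.

End CentralBasis.

Lemma ord_avoid n (n_gt2 : (2 < n)%N) (i l : 'I_n) : exists2 j, i != j & l != j.
Proof.
have : ~~ ([set: 'I_n] \subset [set i; l]).
  apply: contraL n_gt2 => /subset_leq_card; rewrite cardsT card_ord cards2 -leqNgt.
  by move=> le_n; apply: leq_trans le_n _; case: eqP.
by case/subsetPn=> j _; rewrite !inE negb_or !(eq_sym j) => /andP[]; exists j.
Qed.

(** * Elements of degree at most one *)

Section Affine.
Variables (k : fieldType) (n : nat).
Hypothesis k2 : 2%:R != 0 :> k.
Hypothesis n_gt2 : (2 < n)%N.
Local Notation W := (W k n).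
Local Notation x := (W_gen k).
Local Notation wsize := (@wsize k n k2).
Local Notation symb := (@symb k n k2).
Implicit Types (i j : 'I_n) (u v w : W).

Definition affine w := exists c (b : 'I_n -> k), w = c%:A + \sum_i b i *: x i.

Lemma affineD u v : affine u -> affine v -> affine (u + v).
Proof.
move=> [c [b ->]] [d [e ->]]; exists (c + d), (fun i => b i + e i).
rewrite addrACA; congr (_ + _); first by rewrite scalerDl.
rewrite -big_split /=.
by apply: eq_bigr => i _; rewrite scalerDl.
Qed.

Lemma affine_const c : affine c%:A.
Proof. by exists c, (fun=> 0); rewrite big1 ?addr0 // => i _; rewrite scale0r. Qed.

Lemma affine_gen c i : affine (c *: x i).
Proof.
exists 0, (fun j => if j == i then c else 0); rewrite scale0r add0r.
by rewrite (bigD1 i) //= eqxx big1 ?addr0 // => j /negPf ->; rewrite scale0r.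
Qed.

Lemma wsize_le2 w : (wsize w <= 2)%N -> affine w.
Proof.
move=> w2; suff [u au uw] : exists2 u, affine u & symb u = symb w.
  by rewrite -(symb_inj uw).
rewrite [symb w]mpolyE big_seq; elim/big_rec: _ => [|a p aw [u au <-]].
  by exists 0; [rewrite -(scale0r 1); apply: affine_const | rewrite linear0].
have : (mdeg a <= 1)%N by rewrite -ltnS (leq_trans (msize_mdeg_lt aw)).
rewrite leq_eqVlt => /predU1P[/eqP/mdeg1P[i /eqP ->]|].
  exists ((symb w)@_U_(i) *: x i + u); first exact: affineD (affine_gen _ _) au.
  by rewrite linearP /= symb_gen.
rewrite ltnS leqn0 mdeg_eq0 => /eqP ->.
exists (((symb w)@_0%MM)%:A + u); first exact: affineD (affine_const _) au.
by rewrite linearP /= symb1 mpolyX0.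
Qed.

Lemma symb_affine c (b : 'I_n -> k) :
  symb (c%:A + \sum_i b i *: x i) = c *: 1 + \sum_i b i *: 'X_i.
Proof.
rewrite linearD /= linearZ /= symb1 raddf_sum /=; congr (_ + _).
by apply: eq_bigr => i _; rewrite linearZ /= symb_gen.
Qed.

Lemma mcoeff_affine c (b : 'I_n -> k) i :
  (c *: 1 + \sum_j b j *: 'X_j : {mpoly k[n]})@_U_(i) = b i.
Proof.
rewrite mcoeffD mcoeffZ mcoeff1 mnm1_eq0 mulr0 add0r raddf_sum /=.
rewrite (bigD1 i) //= mcoeffZ mcoeffX eqxx mulr1 big1 ?addr0 // => j ji.
by rewrite mcoeffZ mcoeffX eq_mnm1 (negPf ji) mulr0.
Qed.

Lemma scalar_wsize c : (wsize c%:A <= 1)%N.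
Proof. by rewrite (leq_trans (wsizeZ _ _ _)) // wsize_1. Qed.

(** Let v be the linear part with its x_j term removed.  Commuting with x_j makes
    2 x_j v a scalar, which is impossible by degree unless v = 0.  As there are at
    least two generators, every coefficient occurs in such a v. *)
Lemma central_affine w : affine w -> central w -> exists c, w = c%:A.
Proof.
move=> [c [b Ew]] cw; exists c; rewrite Ew big1 ?addr0 // => i _.
have [j ji _] := ord_avoid n_gt2 i i.
suff v0 : \sum_(l | l != j) b l *: x l = 0.
  pose b' l := if l != j then b l else 0.
  have E : 0%:A + \sum_l b' l *: x l = 0.
    rewrite scale0r add0r -[RHS]v0 [RHS]big_mkcond; apply: eq_bigr => l _ /=.
    by rewrite /b'; case: ifP => // _; rewrite scale0r.
  have := congr1 (fun w => (symb w)@_U_(i)) E.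
  by rewrite symb_affine mcoeff_affine linear0 mcoeff0 /b' ji => ->; rewrite scale0r.
set v := \sum_(l | _) _; apply/eqP/contraT => v0.
have Ev : 2%:R *: (x j * v) = (\sum_(l | l != j) b l)%:A.
  have : w * x j = x j * w by exact: cw.
  rewrite Ew mulrDl mulrDr -scalerAl -scalerAr mul1r mulr1 => /addrI.
  rewrite (bigD1 j) //= mulrDl mulrDr -scalerAl -scalerAr => /addrI.
  rewrite -/v => vx; rewrite scaler_nat mulr2n -{1}vx.
  rewrite mulr_suml mulr_sumr -big_split scaler_suml; apply: eq_bigr => l lj /=.
  by rewrite -scalerAl -scalerAr -scalerDr W_genP.
have xj0 : x j != 0 by rewrite -(wsize_gt0 k2) wsize_gen.
have : (wsize (2%:R *: (x j * v)) <= 1)%N by rewrite Ev scalar_wsize.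
rewrite wsizeZ_eq // (wsizeM k2 xj0 v0) wsize_gen.
by move: v0; rewrite -(wsize_gt0 k2); lia.
Qed.

End Affine.

(** * Automorphisms are signed permutations *)

Section AutMorphism.
Variables (k : fieldType) (A : algType k) (f : alg_aut A).
HB.instance Definition _ := GRing.isLinear.Build k A A *:%R f (alg_aut_linear f).
HB.instance Definition _ := GRing.isMonoidMorphism.Build A A f (alg_aut_monoid f).
End AutMorphism.

Section AutAffine.
Variables (k : fieldType) (n : nat).
Hypothesis k2 : 2%:R != 0 :> k.
Hypothesis n_gt2 : (2 < n)%N.
Hypothesis n_even : ~~ odd n.
Local Notation W := (W k n).
Local Notation x := (W_gen k).
Local Notation wsize := (@wsize k n k2).
Local Notation symb := (@symb k n k2).
Local Notation xword := (@xword k n).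
Implicit Types (i j : 'I_n) (u v w : W) (g : alg_aut W).

Lemma aut_scalar g c : g c%:A = c%:A.
Proof. by rewrite linearZ rmorph1. Qed.

Lemma aut_gen_relation g i j : i != j -> g (x i) * g (x j) + g (x j) * g (x i) = 1.
Proof. by move=> ij; rewrite -!rmorphM -rmorphD W_genP // rmorph1. Qed.

Lemma aut_gen_size g i : (1 < wsize (g (x i)))%N.
Proof.
rewrite ltnNge; apply/negP => /wsize_le1[c Ec].
have /(bij_inj (alg_aut_bij g)) Ex : g (x i) = g c%:A by rewrite aut_scalar.
by have := scalar_wsize n k2 c; rewrite -Ex wsize_gen.
Qed.

Lemma aut_xword g r : g (xword r) = yword (fun i => g (x i)) r.
Proof. exact: rmorph_prod. Qed.

(** The inverse f turns the expansion of g (x_j) over the centre into an expansion of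
    x_j itself, of degree 1, in terms of the images f (x_i); [wsize_term_le] bounds
    every term, and the scalar coefficients so found are fixed by g. *)
Lemma aut_gen_affine g j : affine (g (x j)).
Proof.
have [f [gf fg]] := alg_aut_inv_subproof g.
have [z cz Eg] := central_decomposition (g (x j)).
have cfz S : central (f (z S)).
  by move=> w; rewrite -(gf w) -!rmorphM cz.
have bound S : (wsize (f (z S) * yword (fun i => f (x i)) (enum S))%R <= 2)%N.
  have Ex : x j = \sum_S f (z S) * yword (fun i => f (x i)) (enum S).
    rewrite -[LHS]gf Eg raddf_sum; apply: eq_bigr => T _ /=.
    by rewrite rmorphM /= aut_xword.
  rewrite -(wsize_gen k2 j) Ex.
  exact: (wsize_term_le (@aut_gen_relation f) (aut_gen_size f) cfz n_even S).
have scalar S c : f (z S) = c%:A -> z S = c%:A.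
  by move/(congr1 g); rewrite fg aut_scalar.
rewrite Eg; elim/big_rec: _ => [|S u _ au].
  by rewrite -(scale0r 1); apply: affine_const.
apply: affineD au; have := bound S; have [z0|z0] := eqVneq (f (z S)) 0.
  rewrite (scalar S 0) ?scale0r // mul0r => _.
  by rewrite -(scale0r 1); apply: affine_const.
have y_size := yword_size (aut_gen_size f) (enum S).
rewrite (wsizeM k2 z0 (yword_neq0 (aut_gen_size f) _)).
rewrite -(wsize_gt0 k2) in z0; rewrite -cardE in y_size.
have size_arith a b m : ((a + b).-1 <= 2 -> m < b -> 0 < a -> m <= 1 /\ a <= 2 - m)%N.
  by lia.
move=> le2; have [S_le1 fz_size] := size_arith _ _ _ le2 y_size z0.
case: (posnP #|S|) => [/eqP|S_gt0].
  rewrite cards_eq0 => /eqP S0; rewrite S0 ?cards0 in fz_size *.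
  have [c /scalar ->] := central_affine k2 n_gt2 (wsize_le2 fz_size) (@cfz _).
  by rewrite enum_set0 /xword big_nil mulr1; apply: affine_const.
have /cards1P[i ES] : #|S| == 1%N by rewrite eqn_leq S_le1.
rewrite ES ?cards1 in fz_size *; have [c /scalar ->] := wsize_le1 fz_size.
by rewrite enum_set1 /xword big_seq1 -scalerAl mul1r; apply: affine_gen.
Qed.

Lemma annihU i : annih 'X_i = 1 :> {mpoly k[n]}.
Proof.
rewrite annihX (bigD1 i) //= mnm1E eqxx /= big1 ?addr0 => [|j /negPf ji]; last first.
  by rewrite mnm1E eq_sym ji.
rewrite deg_below_var ltnn expr0 scale1r -[X in (X - _)%MM]add0m addmK.
exact: mpolyX0.
Qed.

Lemma act_gen1 i : act_gen i 1 = 'X_i :> {mpoly k[n]}.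
Proof. by rewrite /act_gen create1 annih1 scaler0 addr0. Qed.

Lemma mcoeff_actU i j t : (act_gen i 'X_j : {mpoly k[n]})@_U_(t) = 0.
Proof.
rewrite /act_gen createX annihU mcoeffD !mcoeffZ mcoeffX mcoeff1 mnm1_eq0.
rewrite mulr0 addr0 (_ : _ == _ = false) ?mulr0 //; apply/negP => /eqP/(congr1 mdeg).
by rewrite mdegD !mdeg1.
Qed.

Lemma mcoeff_actUU i j t :
  (act_gen i 'X_j : {mpoly k[n]})@_(U_(t) + U_(t)) = ((i == t) && (j == t))%:R.
Proof.
rewrite /act_gen createX annihU mcoeffD !mcoeffZ mcoeffX mcoeff1 mnmD_eq0 mnm1_eq0.
rewrite mulr0 addr0; case: (eqVneq i t) => [->|it].
  rewrite eqm_add2l eq_mnm1 /=; case: eqVneq => [->|_]; last by rewrite mulr0.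
  by rewrite deg_below_var ltnn mulr1.
rewrite (_ : _ == _ = false) ?mulr0 //; apply/negP => /eqP/mnmP/(_ i).
by rewrite !mnmDE !mnm1E eqxx (eq_sym t) (negPf it).
Qed.

Lemma symb_affineM c (b : 'I_n -> k) v :
  symb ((c%:A + \sum_i b i *: x i) * v) =
  c *: symb v + \sum_i b i *: act_gen i (symb v).
Proof.
rewrite mulrDl -scalerAl mul1r linearD /= linearZ /= mulr_suml raddf_sum /=.
congr (_ + _); apply: eq_bigr => i _.
by rewrite -scalerAl linearZ /= symbX.
Qed.

(** The symbol of a product of two generators lives in degrees 2 and 0, and the square
    of the t-th variable occurs only in that of x_t^2.  Hence the coefficients in
    degree 1 come from scalars times generators, those of squares from the diagonal. *)
Lemma mcoeff_affineM u v c (b : 'I_n -> k) d (e : 'I_n -> k) t :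
  u = c%:A + \sum_i b i *: x i -> v = d%:A + \sum_i e i *: x i ->
  (symb (u * v))@_U_(t) = c * e t + b t * d
  /\ (symb (u * v))@_(U_(t) + U_(t)) = b t * e t.
Proof.
move=> -> ->; rewrite symb_affineM !symb_affine.
have act i : act_gen i (d *: 1 + \sum_j e j *: 'X_j) =
    d *: 'X_i + \sum_j e j *: act_gen i 'X_j :> {mpoly k[n]}.
  rewrite linearD linearZ /= act_gen1 raddf_sum /=; congr (_ + _).
  by apply: eq_bigr => j _; rewrite linearZ.
have -> : \sum_i b i *: act_gen i (d *: 1 + \sum_j e j *: 'X_j) =
    \sum_i b i *: (d *: 'X_i + \sum_j e j *: act_gen i 'X_j).
  by apply: eq_bigr => i _; rewrite act.
split.
  rewrite mcoeffD mcoeffZ mcoeff_affine raddf_sum /=; congr (_ + _).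
  have actU i : (d *: 'X_i + \sum_j e j *: act_gen i 'X_j)@_U_(t) = (i == t)%:R * d.
    rewrite mcoeffD mcoeffZ mcoeffXU raddf_sum big1 ?addr0 1?mulrC // => j _.
    by rewrite /= mcoeffZ mcoeff_actU mulr0.
  rewrite (bigD1 t) //= mcoeffZ actU eqxx mul1r big1 ?addr0 // => i /negPf it.
  by rewrite mcoeffZ actU it mul0r mulr0.
have UU (m : 'I_n) : (U_(m)%MM == (U_(t) + U_(t))%MM) = false.
  by apply/negP => /eqP/(congr1 mdeg); rewrite mdegD !mdeg1.
rewrite mcoeffD mcoeffZ mcoeffD mcoeffZ mcoeff1 mnmD_eq0 mnm1_eq0 mulr0 add0r.
rewrite raddf_sum big1 ?mulr0 ?add0r => [|j _]; last first.
  by rewrite /= mcoeffZ mcoeffX UU mulr0.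
have actUU i : (d *: 'X_i + \sum_j e j *: act_gen i 'X_j)@_(U_(t) + U_(t)) =
    (i == t)%:R * e t.
  rewrite mcoeffD mcoeffZ mcoeffX UU mulr0 add0r raddf_sum /= (bigD1 t) //=.
  rewrite mcoeffZ mcoeff_actUU eqxx andbT big1 ?addr0 1?mulrC // => j /negPf jt.
  by rewrite mcoeffZ mcoeff_actUU jt andbF mulr0.
rewrite raddf_sum (bigD1 t) //= mcoeffZ actUU eqxx mul1r big1 ?addr0 // => i /negPf it.
by rewrite mcoeffZ actUU it mul0r mulr0.
Qed.

Lemma aut_classification g :
  exists s : 'S_n, exists e : bool, forall i, g (x i) = (-1) ^+ e *: x (s i).
Proof.
have [c Hc] := fin_all_exists (aut_gen_affine g).
have {Hc}[B gE] := fin_all_exists Hc.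
have rel i l t : i != l -> c i * B l t + B i t * c l = 0 /\ B i t * B l t = 0.
  move=> il; have E := aut_gen_relation g il.
  have [P1 P2] := mcoeff_affineM t (gE i) (gE l).
  have [Q1 Q2] := mcoeff_affineM t (gE l) (gE i).
  have {}E := congr1 symb E.
  rewrite linearD /= symb1 in E.
  have E1 := congr1 (fun p => p@_U_(t)) E; have E2 := congr1 (fun p => p@_(U_(t) + U_(t))) E.
  move: E1 E2; rewrite /= !mcoeffD P1 P2 Q1 Q2 !mcoeff1 mnmD_eq0 !mnm1_eq0 => E1 E2.
  split; apply: (mulfI k2); rewrite mulr0.
    by rewrite -[RHS]E1; ring.
  by rewrite -[RHS]E2; ring.
(* A zero row would make the image of a generator a scalar. *)
have row_neq0 i : exists t, B i t != 0.
  apply/existsP; apply: contraT; rewrite negb_exists => /forallP B0.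
  have := aut_gen_size g i; rewrite gE big1 ?addr0 => [|t _].
    by rewrite ltnNge scalar_wsize.
  by move: (B0 t); rewrite negbK => /eqP ->; rewrite scale0r.
(* Rows have disjoint supports, so at a nonzero entry of another row l the linear
   relation between rows i and l reduces to its constant term. *)
have c0 i : c i = 0.
  have [l il _] := ord_avoid n_gt2 i i; have [t Bt] := row_neq0 l.
  have [/eqP E /eqP] := rel _ _ t il; rewrite mulf_eq0 (negPf Bt) orbF => /eqP Bi.
  by move: E; rewrite Bi mul0r addr0 mulf_eq0 (negPf Bt) orbF => /eqP.
have [s sP] := fin_all_exists row_neq0.
have s_inj : injective s.
  move=> i l sil; apply/eqP; apply: contraT => il.
  have [_ /eqP] := rel _ _ (s i) il; rewrite mulf_eq0 (negPf (sP i)) sil.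
  by rewrite (negPf (sP l)).
have B0 i j : j != s i -> B i j = 0.
  move=> jsi; have := injF_onto s_inj j => /codomP[l El].
  have il : i != l by apply: contraNneq jsi => ->; rewrite El.
  have [_ /eqP] := rel _ _ j il; rewrite mulf_eq0.
  by rewrite {2}El (negPf (sP l)) orbF => /eqP.
pose b i := B i (s i).
have {}gE i : g (x i) = b i *: x (s i).
  rewrite gE c0 scale0r add0r (bigD1 (s i)) //= big1 ?addr0 // => j /B0 ->.
  by rewrite scale0r.
(* The linear parts being single generators, the relation reads b_i b_l = 1. *)
have bb i l : i != l -> b i * b l = 1.
  move=> il; have := aut_gen_relation g il; rewrite !gE -!scalerAl -!scalerAr !scalerA.
  rewrite [b l * _]mulrC -scalerDr W_genP ?(inj_eq s_inj) // => /(congr1 symb).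
  rewrite linearZ /= symb1 => /(congr1 (fun p => p@_0%MM)).
  by rewrite mcoeffZ mcoeff1 eqxx mulr1.
pose i0 := Ordinal (ltn_trans (ltn0Sn 1) n_gt2).
have b_neq0 i : b i != 0 by apply: sP.
have b_const i : b i = b i0.
  have [l il i0l] := ord_avoid n_gt2 i i0.
  by apply: (mulIf (b_neq0 l)); rewrite !bb.
have : b i0 ^+ 2 == 1.
  have [l il _] := ord_avoid n_gt2 i0 i0.
  by rewrite expr2 -{2}(b_const l) bb.
rewrite sqrf_eq1 => /orP[]/eqP b0.
  by exists (perm s_inj), false => i; rewrite permE gE b_const b0.
by exists (perm s_inj), true => i; rewrite permE gE b_const b0.
Qed.

End AutAffine.

Section SignedPermutation.
Variables (k : fieldType) (n : nat).
Local Notation W := (W k n).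
Local Notation x := (W_gen k).
Implicit Types (s : 'S_n) (e : 'Z_2) (i : 'I_n).

Lemma W_endo_ext (f g : W -> W) : linear f -> linear g ->
  monoid_morphism f -> monoid_morphism g -> (forall i, f (x i) = g (x i)) -> f =1 g.
Proof.
move=> lf lg [f1 fM] [g1 gM] fg; elim/W_ind => [|a u v fu fv|i u fu].
- by rewrite f1 g1.
- by rewrite lf lg fu fv.
- by rewrite fM gM fg fu.
Qed.

Lemma aut_ext (f g : alg_aut W) : (forall i, f (x i) = g (x i)) -> f = g.
Proof.
move=> fg; apply/alg_autP/W_endo_ext => //; try exact: alg_aut_linear.
  exact: alg_aut_monoid.
exact: alg_aut_monoid.
Qed.

Lemma sign_Z2M e e' : (-1) ^+ (e + e')%R = (-1) ^+ e * (-1) ^+ e' :> k.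
Proof.
by case: e e' => [[|[|//]] ?] [[|[|//]] ?]; rewrite -signr_odd -exprD -[RHS]signr_odd.
Qed.

Definition sperm_gen s e i : W := (-1) ^+ e *: x (s i).

Lemma sperm_genP s e i j : i != j ->
  sperm_gen s e i * sperm_gen s e j + sperm_gen s e j * sperm_gen s e i = 1.
Proof.
move=> ij; rewrite /sperm_gen -!scalerAl -!scalerAr -!scalerDr scalerA.
rewrite W_genP ?(inj_eq perm_inj) //.
by rewrite -exprD addnn -signr_odd odd_double expr0 scale1r.
Qed.

Definition sperm_fun s e : W -> W := W_lift (sperm_gen s e).

Lemma sperm_linear s e : linear (sperm_fun s e).
Proof. exact: W_lift_linear (@sperm_genP s e). Qed.

Lemma sperm_monoid s e : monoid_morphism (sperm_fun s e).
Proof. exact: W_lift_monoid (@sperm_genP s e). Qed.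

Lemma sperm_funX s e i : sperm_fun s e (x i) = (-1) ^+ e *: x (s i).
Proof. exact: W_lift_gen (@sperm_genP s e) i. Qed.

Lemma sperm_funZ s e a u : sperm_fun s e (a *: u) = a *: sperm_fun s e u.
Proof.
have f0 : sperm_fun s e 0 = 0.
  have := sperm_linear s e (-1) 0 0; rewrite scaler0 addr0 scaleN1r => {1}->.
  by rewrite addNr.
by have := sperm_linear s e a u 0; rewrite !addr0 f0 addr0.
Qed.

Lemma sperm_cancel s e : cancel (sperm_fun s e) (sperm_fun s^-1 e).
Proof.
move=> u; apply: (@W_endo_ext (sperm_fun s^-1 e \o sperm_fun s e) id) => //.
- by move=> a v w /=; rewrite !sperm_linear.
- have [[f1 fM] [g1 gM]] := (sperm_monoid s e, sperm_monoid s^-1 e).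
  by split=> [|v w] /=; rewrite ?f1 ?g1 ?fM ?gM.
- move=> i /=; rewrite sperm_funX sperm_funZ sperm_funX permK scalerA -exprD.
  by rewrite addnn -signr_odd odd_double expr0 scale1r.
Qed.

Lemma sperm_bij s e : bijective (sperm_fun s e).
Proof.
exists (sperm_fun s^-1 e); first exact: sperm_cancel.
by rewrite -{2}[s]invgK; apply: sperm_cancel.
Qed.

Definition sperm_aut (se : 'S_n * 'Z_2) : alg_aut W :=
  AlgAut (sperm_linear se.1 se.2) (sperm_monoid se.1 se.2) (sperm_bij se.1 se.2).

Fact sperm_autM : {morph sperm_aut : a b / (a * b)%g >-> (a * b)%g}.
Proof.
move=> [s e] [s' e']; apply: aut_ext => i /=.
by rewrite !sperm_funX sperm_funZ sperm_funX scalerA permM sign_Z2M.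
Qed.
HB.instance Definition _ :=
  isMultiplicative.Build ('S_n * 'Z_2)%type (alg_aut W) sperm_aut sperm_autM.

Lemma sperm_aut_inj : 2%:R != 0 :> k -> (1 < n)%N -> injective sperm_aut.
Proof.
move=> k2 n_gt1 [s e] [s' e'] E.
have Ei i : (-1) ^+ e *: 'X_(s i) = (-1) ^+ e' *: 'X_(s' i) :> {mpoly k[n]}.
  have := congr1 (fun f : alg_aut W => @symb k n k2 (f (x i))) E.
  by rewrite /= !sperm_funX !linearZ /= !symb_gen.
have coef i : (-1) ^+ e = (-1) ^+ e' * (s' i == s i)%:R :> k.
  have := congr1 (mcoeff U_(s i)) (Ei i).
  by rewrite !mcoeffZ !mcoeffXU eqxx mulr1.
have ss i : s' i = s i.
  have := coef i; case: eqP => // _ /eqP; by rewrite mulr0 signr_eq0.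
have i0 := Ordinal (ltnW n_gt1).
have := coef i0; rewrite ss eqxx mulr1 => ee.
have -> : s = s' by apply/permP => i; rewrite ss.
congr pair; apply/val_inj; move: ee.
have N1 : -1 != 1 :> k.
  by apply: contra k2 => /eqP N1; rewrite mulr2n -{1}N1 addNr.
case: e e' {E Ei coef} => [[|[|//]] ?] [[|[|//]] ?] //=; rewrite expr0 expr1 => /eqP.
  by rewrite eq_sym (negPf N1).
by rewrite (negPf N1).
Qed.

Lemma sperm_aut_onto : 2%:R != 0 :> k -> (2 < n)%N -> ~~ odd n ->
  forall g, exists se, sperm_aut se = g.
Proof.
move=> k2 n_gt2 n_even g; have [s [e gE]] := aut_classification k2 n_gt2 n_even g.
exists (s, (e : nat)%:R); apply: aut_ext => i /=.
by rewrite sperm_funX gE; case: e {gE}.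
Qed.

End SignedPermutation.

Theorem theorem1 (k : fieldType) (n : nat)
    (char_k : 2%N \notin [pchar k]) (n_ge4 : (4 <= n)%N) (n_even : ~~ odd n) :
  exists phi : {multiplicative ('S_n * 'Z_2)%type -> alg_aut (W k n)},
    (forall (s : 'S_n) (e : 'Z_2) (i : 'I_n),
        phi (s, e) (W_gen k i) = (-1) ^+ e *: W_gen k (s i))
    /\ bijective phi.
Proof.
have k2 : 2%:R != 0 :> k by apply: contra char_k => k20; rewrite inE /= k20.
exists (@sperm_aut k n : {multiplicative _ -> _}); split=> [s e i|].
  exact: sperm_funX.
have inj := sperm_aut_inj k2 (ltnW (ltnW n_ge4)).
pose h g := odflt (1 : 'S_n, 0 : 'Z_2)%g [pick se | sperm_aut k se == g].
have hK : cancel h (@sperm_aut k n).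
  move=> g; rewrite /h; case: pickP => [se /eqP //|noP].
  have [se E] := sperm_aut_onto k2 (ltnW n_ge4) n_even g.
  by have := noP se; rewrite E eqxx.
by exists h => // se; apply: inj; rewrite hK.
Qed.
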